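(* Let $X$ be a first countable $T_0$ space. Then the following conditions are equivalent: (1) $X$ is a sober space. (2) $X$ is a well-filtered space. (3) $X$ is an $\omega$-well-filtered $d$-space.
   Context: A subset of a space is saturated if it is an intersection of open sets. A family of sets is filtered if it is nonempty and any two members contain a third member of the family. A $T_0$ space $X$ is well-filtered if for every open $U$ and every filtered family $\mathcal K$ of nonempty compact saturated subsets of $X$, $\bigcap\mathcal K\subseteq U$ implies $K\subseteq U$ for some $K\in\mathcal K$; it is $\omega$-well-filtered if this holds for every countable filtered family $\{K_i : i<\omega\}$ of nonempty compact saturated sets. A nonempty set $A\subseteq X$ is irreducible if for all closed $F_1,F_2$, $A\subseteq F_1\cup F_2$ implies $A\subseteq F_1$ or $A\subseteq F_2$. $X$ is sober if for every irreducible closed set $F$ there is a unique point $a\in X$ with $F=\overline{\{a\}}$. The specialization order is $x\leq y$ iff $x\in\overline{\{y\}}$. A $T_0$ space $X$ is a $d$-space (monotone convergence space) if $X$ with its specialization order is a dcpo (every directed subset has a supremum, directed sets being nonempty) and every open set of $X$ is Scott open for the specialization order. *)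

(* Defs.v *)
From mathcomp Require Import all_boot all_classical topology.

Set Implicit Arguments.
Unset Strict Implicit.
Unset Printing Implicit Defensive.

Local Open Scope classical_set_scope.

Section OrderTheoretic.
Context {T : Type} (le : T -> T -> Prop).

Definition directed (D : set T) :=
  D !=set0 /\
  forall x y, D x -> D y -> exists z, [/\ D z, le x z & le y z].

Definition is_supremum (D : set T) (s : T) :=
  (forall x, D x -> le x s) /\
  (forall u, (forall x, D x -> le x u) -> le s u).

(* Only completeness is recorded here: [le] is used with the specialization
   order of a T0 space, which is a partial order. *)
Definition directed_complete :=
  forall D, directed D -> exists s, is_supremum D s.

Definition scott_open (U : set T) :=
  (forall x y, U x -> le x y -> U y) /\
  (forall D s, directed D -> is_supremum D s -> U s -> (D `&` U) !=set0).

End OrderTheoretic.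

Definition filtered_family {T : Type} (KK : set (set T)) :=
  KK !=set0 /\
  forall A B, KK A -> KK B -> exists C, [/\ KK C, C `<=` A & C `<=` B].

Section Sets.
Context {T : topologicalType}.

(* The empty family is allowed; its intersection is the whole space. *)
Definition saturated (A : set T) :=
  exists2 UU : set (set T), UU `<=` open & A = \bigcap_(U in UU) U.

Definition nonempty_compact_saturated (K : set T) :=
  [/\ K !=set0, compact K & saturated K].

Definition irreducible (A : set T) :=
  A !=set0 /\
  forall F1 F2 : set T, closed F1 -> closed F2 ->
    A `<=` F1 `|` F2 -> A `<=` F1 \/ A `<=` F2.

Definition specialization (x y : T) := closure [set y] x.

End Sets.

Section Spaces.
Variable T : topologicalType.

Definition first_countable :=
  forall x : T, exists B : set (set T),
    [/\ countable B, B `<=` nbhs x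
      & forall N, nbhs x N -> exists2 V, B V & V `<=` N].

Definition sober :=
  forall F : set T, closed F -> irreducible F ->
    exists! a : T, F = closure [set a].

Definition well_filtered :=
  kolmogorov_space T /\
  forall (U : set T) (KK : set (set T)),
    open U -> filtered_family KK -> KK `<=` nonempty_compact_saturated ->
    \bigcap_(K in KK) K `<=` U -> exists2 K, KK K & K `<=` U.

Definition omega_well_filtered :=
  kolmogorov_space T /\
  forall (U : set T) (K : nat -> set T),
    open U -> filtered_family (range K) ->
    (forall i, nonempty_compact_saturated (K i)) ->
    \bigcap_i K i `<=` U -> exists i, K i `<=` U.

Definition d_space :=
  [/\ kolmogorov_space T,
      directed_complete (@specialization T)
    & forall U : set T, open U -> scott_open specialization U].

End Spaces.

(* Main.v *)
Require Import Defs.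
From mathcomp Require Import all_boot all_classical topology.

(** Why the conditions are equivalent.

    Sober implies well-filtered.  Suppose that no member of
    the filtered family [KK] lies in the open set [U].  By Zorn's lemma there
    is an irreducible closed set [C] outside [U] which meets every member of
    [KK] ([topological_rudin]).  Sobriety makes [C] the closure of a point [a];
    each member of [KK] contains a point below [a], hence contains [a] because
    it is saturated.  So [a] lies in the intersection of [KK] but not in [U].

    Well-filtered implies d-space.  If [D] is directed, the
    principal upper sets of its points form a filtered family of compact
    saturated sets, none of which is contained in the complement of the closure
    of [D].  Their intersection therefore meets the closure of [D]; a point in
    both is an upper bound of [D] adherent to [D], and such a point is a
    supremum which witnesses Scott openness of every open set.

    For the converse, first countability enters through sequences.  Let [A] be
    irreducible and closed, and [x], [y] in [A].  Choosing each new term in the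
    [n]-th basic neighbourhoods of [x], of [y] and of all earlier terms, which
    is possible since [A] is irreducible, gives a sequence in [A] that
    converges to [x], to [y] and to each of its own terms
    ([irreducible_self_convergent]).  The upper set generated by a tail of such
    a sequence is compact, because a neighbourhood of the first term of the tail
    misses only finitely many terms ([compact_up_tail]).  Since all these tails
    meet [A], omega-well-filteredness yields a point of [A] in all of them, and
    this point lies above every limit of the sequence, in particular above [x]
    and [y].  Hence [A] is directed ([irreducible_directed]).  In a d-space [A]
    has a supremum, which belongs to [A] since the complement of [A] is Scott
    open, and [A] is the closure of it. *)

Set Implicit Arguments.
Unset Strict Implicit.
Unset Printing Implicit Defensive.

Local Open Scope classical_set_scope.

(** * The specialization order *)

Section Specialization.
Context {T : topologicalType}.
Implicit Types (x y z : T) (A U K : set T).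

Definition up x : set T := [set y | specialization x y].

Lemma specialization_refl x : specialization x x.
Proof. exact: subset_closure. Qed.

Lemma closure_sub_closed (A B : set T) :
  closed B -> A `<=` B -> closure A `<=` B.
Proof.
by move=> cB AB; rewrite [X in _ `<=` X](closure_id B).1//; exact: closureS.
Qed.

Lemma closed_specialization A x y :
  closed A -> specialization x y -> A y -> A x.
Proof.
by move=> cA xy Ay; apply: closure_sub_closed xy => // _ ->.
Qed.

Lemma specialization_trans x y z :
  specialization x y -> specialization y z -> specialization x z.
Proof.
by move=> xy yz; apply: closed_specialization xy yz; exact: closed_closure.
Qed.

Lemma nbhs_specialization x y N : nbhs x N -> specialization x y -> N y.
Proof. by move=> xN /(_ _ xN)[_ [->]]. Qed.

Lemma specializationP x y :
  specialization x y <-> forall N, nbhs x N -> N y.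
Proof.
split=> [xy N xN|xy N /xy Ny]; first exact: nbhs_specialization xN xy.
by exists y.
Qed.

Lemma closure1_inj : kolmogorov_space T -> injective (fun x => closure [set x]).
Proof.
move=> T0 x y xy; apply: contrapT => /eqP /T0 [N].
have {}xy : specialization x y /\ specialization y x.
  split; first by rewrite /specialization -xy; exact: specialization_refl.
  by rewrite /specialization xy; exact: specialization_refl.
by rewrite !inE => -[[Nx]|[Nx]]; apply; apply: nbhs_specialization Nx _;
  case: xy.
Qed.

(** For the converse direction, a point [x] outside the upper set [A] is
    separated from it by the complement of the closure of [x], the largest open
    set that avoids [x]. *)
Lemma saturatedP A :
  saturated A <-> forall x y, A x -> specialization x y -> A y.
Proof.
split=> [[UU oUU ->] x y Ux xy U UU_U|upA].
  apply: nbhs_specialization xy; apply: open_nbhs_nbhs.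
  by split; [exact: oUU|exact: Ux].
exists [set U | open U /\ A `<=` U]; first by move=> U [].
apply/seteqP; split=> [x Ax U [_]|x AUx]; first exact.
apply: contrapT => nAx; apply: (AUx (~` closure [set x])); last first.
  exact: specialization_refl.
split; first by rewrite openC; exact: closed_closure.
by move=> y Ay yx; apply: nAx; exact: upA yx.
Qed.

(** Every neighbourhood of [x] contains the whole of [up x], so [x] is a cluster
    point of every proper filter on [up x]. *)
Lemma compact_up x : compact (up x).
Proof.
move=> F FF Fx; exists x; split; first exact: specialization_refl.
move=> B N FB xN; have [y [By xy]] := filter_ex (filterI FB Fx).
by exists y; split=> //; exact: nbhs_specialization xy.
Qed.

Lemma up_nonempty_compact_saturated x : nonempty_compact_saturated (up x).
Proof.
split; [by exists x; exact: specialization_refl|exact: compact_up|].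
by apply/saturatedP => y z; exact: specialization_trans.
Qed.

End Specialization.

(** * From sober to well-filtered *)

Section WellFiltered.
Context {T : topologicalType}.

(** Otherwise the sets [K `\` W] generate a proper filter on [K], and a cluster
    point of it would lie in no member of the cover. *)
Lemma compact_directed_cover (K : set T) (OO : set (set T)) :
  compact K -> directed subset OO -> OO `<=` open ->
  K `<=` \bigcup_(W in OO) W -> exists2 W, OO W & K `<=` W.
Proof.
move=> cK [[W0 OW0] dirO] oO KO; apply: contrapT => nKO.
pose F := filter_from OO (fun W => K `\` W).
have FF : ProperFilter F.
  apply: filter_from_proper; last first.
    move=> W OW; apply/set0P/negP=> /eqP; rewrite setD_eq0 => KW.
    by apply: nKO; exists W.
  apply: filter_from_filter; first by exists W0.
  move=> V W OV OW; have [Z [OZ VZ WZ]] := dirO _ _ OV OW.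
  by exists Z => // x [Kx nZx]; split; split=> //; [move/VZ|move/WZ].
have FK : F K by exists W0 => // x [].
have [p [Kp clp]] := cK F FF FK.
have [W OW Wp] := KO p Kp.
have FW : F (K `\` W) by exists W.
have Wnp : nbhs p W by apply: open_nbhs_nbhs; split=> //; exact: oO.
by have [q [[_ nWq] Wq]] := clp _ _ FW Wnp.
Qed.

(** The topological Rudin lemma.  The set [C] is the complement of an open set
    [A] that is maximal among those for which [A `|` U] contains no member of
    [KK].  Maximality forces [U `<=` A].  If [~` A] were covered by closed sets
    [F1] and [F2], neither of which contains it, then by maximality
    [A `|` ~` F1] and [A `|` ~` F2] would each contain a member of [KK], and by
    filteredness so would their intersection, which is [A]. *)
Lemma topological_rudin (U : set T) (KK : set (set T)) :
  open U -> filtered_family KK -> KK `<=` compact ->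
  (forall K, KK K -> ~ K `<=` U) ->
  exists C : set T, [/\ closed C, irreducible C, C `&` U = set0 &
    forall K, KK K -> K `&` C !=set0].
Proof.
move=> oU [[K0 KK0] filtK] cK nKU.
(* Adding [U] here, instead of asking that [U `<=` W], lets the empty chain
   have an upper bound. *)
pose P W := open W /\ forall K, KK K -> ~ K `<=` W `|` U.
have [F FP chF|A [[oA nKA] maxA]] := @Zorn_bigcup _ P.
  split; first by apply: bigcup_open => W /FP[].
  move=> K KK_K KF.
  (* The empty set is put in so that the family is nonempty even when the
     chain [F] is empty. *)
  pose OO := [set W `|` U | W in set0 |` F].
  have [||x Kx|_ [W FW <-] KW] :=
    @compact_directed_cover K OO (cK _ KK_K).
  - split; first by exists (set0 `|` U), set0 => //; left.
    move=> _ _ [V FV <-] [W FW <-].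
    have [Z [FZ VZ WZ]] :
        exists Z, [/\ (set0 |` F) Z, V `<=` Z & W `<=` Z].
      case: FV => [->|FV]; first by exists W; split=> //; exact: sub0set.
      case: FW => [->|FW]; first by exists V; split=> //; right.
      by have [VW|WV] := chF V W FV FW; [exists W|exists V]; split=> //; right.
    by exists (Z `|` U); split; [exists Z|exact: setSU|exact: setSU].
  - move=> _ [W FW <-]; apply: openU => //.
    by case: FW => [->|/FP[]//]; exact: open0.
  - have [[W FW Wx]|Ux] := KF x Kx.
      by exists (W `|` U); [exists W => //; right|left].
    by exists (set0 `|` U); [exists set0 => //; left|right].
  - case: FW KW => [->|FW KW]; first by rewrite set0U; exact: nKU.
    by have [_ /(_ K KK_K)] := FP W FW; apply.
have UA : U `<=` A.
  apply: contrapT => nUA; apply: (maxA (A `|` U)).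
    split; first exact: subsetUl.
    by move=> AUA; apply: nUA => x Ux; apply: AUA; right.
  split; first exact: openU.
  by move=> K KK_K; rewrite -setUA setUid; exact: nKA.
have AU : A `|` U = A by apply/setUidPl.
rewrite AU in nKA.
have enlarge F : closed F -> ~ ~` A `<=` F ->
    exists2 K, KK K & K `<=` A `|` ~` F.
  move=> cF nAF; apply: contrapT => nK; apply: (maxA (A `|` ~` F)).
    split; first exact: subsetUl.
    move=> AFA; apply: nAF => x nAx; apply: contrapT => nFx.
    by apply: nAx; apply: AFA; right.
  split; first by apply: openU => //; rewrite openC.
  by move=> K KK_K; rewrite setUAC AU => KAF; apply: nK; exists K.
exists (~` A); split.
- by rewrite closedC.
- split.
    apply/set0P/negP => /eqP nA0; apply: (nKA K0 KK0) => x _.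
    by apply: contrapT => nAx; have : set0 x by rewrite -nA0.
  move=> F1 F2 cF1 cF2 AF; apply: contrapT => /not_orP[nF1 nF2].
  have [K1 KK1 K1F] := enlarge F1 cF1 nF1.
  have [K2 KK2 K2F] := enlarge F2 cF2 nF2.
  have [K3 [KK3 K31 K32]] := filtK K1 K2 KK1 KK2.
  apply: (nKA K3 KK3) => x K3x; apply: contrapT => nAx.
  have [//|nF1x] := K1F x (K31 x K3x); have [//|nF2x] := K2F x (K32 x K3x).
  by have [] := AF x nAx.
- by apply/seteqP; split=> // x [nAx /UA].
- move=> K KK_K; apply: contrapT => nKC; apply: (nKA K KK_K) => x Kx.
  by apply: contrapT => nAx; apply: nKC; exists x.
Qed.

Lemma sober_well_filtered :
  kolmogorov_space T -> sober T -> well_filtered T.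
Proof.
move=> T0 sobT; split=> // U KK oU fK KKn KU; apply: contrapT => nKU.
have [K KKK|K KK_K KU'|C [cC iC CU CK]] := topological_rudin oU fK.
- by case: (KKn K KKK).
- by apply: nKU; exists K.
have [a [Ca _]] := sobT C cC iC.
have Ca' : C a by rewrite Ca; exact: specialization_refl.
suff : (C `&` U) a by rewrite CU.
split=> //; apply: KU => K KKK; have [x [Kx]] := CK K KKK.
rewrite Ca => xa; have [_ _ /saturatedP] := KKn K KKK.
by apply; first exact: Kx.
Qed.

(** * From well-filtered to omega-well-filtered d-spaces *)

Lemma well_filtered_omega : well_filtered T -> omega_well_filtered T.
Proof.
move=> [T0 wf]; split=> // U K oU fK Kn KU.
have [_ [i _ <-]|x Kx|_ [i _ <-] KiU] := wf U (range K) oU fK.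
- exact: Kn.
- by apply: KU => i _; apply: Kx; exists i.
- by exists i.
Qed.

Lemma well_filtered_d_space : well_filtered T -> d_space T.
Proof.
move=> [T0 wf].
(* A point as below is automatically the supremum of [D]: an upper bound [u] of
   [D] has [D] in the closure of [u], which then contains [closure D]. *)
have adherent_bound D : directed specialization D ->
    exists2 a : T, closure D a & forall x, D x -> specialization x a.
  move=> [[d0 Dd0] dirD]; apply: contrapT => na.
  have [||_ [d Dd <-]|x Dx xD|_ [d Dd <-] dD] :=
    wf (~` closure D) [set up d | d in D].
  - by rewrite openC; exact: closed_closure.
  - split; first by exists (up d0); exists d0.
    move=> _ _ [x Dx <-] [y Dy <-]; have [z [Dz xz yz]] := dirD x y Dx Dy.
    exists (up z); split; first by exists z.
      by move=> w; exact: specialization_trans.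
    by move=> w; exact: specialization_trans.
  - exact: up_nonempty_compact_saturated.
  - by apply: na; exists x => // d Dd; apply: (Dx (up d)); exists d.
  - by apply: (dD d (@specialization_refl _ d)); exact: subset_closure.
split=> // [D /adherent_bound[a Da aub]|U oU].
  exists a; split=> // u uub; move: a Da {aub}.
  by apply: closure_sub_closed => //; exact: closed_closure.
split=> [x y Ux xy|D s /adherent_bound[a Da aub] [_ sleast] Us].
  by apply: nbhs_specialization xy; apply: open_nbhs_nbhs.
have /Da : nbhs a U; last by [].
apply: open_nbhs_nbhs; split=> //.
apply: nbhs_specialization (sleast a aub).
exact: open_nbhs_nbhs.
Qed.

End WellFiltered.

(** * From first countable omega-well-filtered d-spaces to sober spaces *)

Section FirstCountable.
Context {T : topologicalType}.

Lemma decreasing_nbhs_base : first_countable T ->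
  exists W : T -> nat -> set T, forall x,
    (forall n, nbhs x (W x n)) /\
    forall N, nbhs x N -> \forall n \near \oo, W x n `<=` N.
Proof.
move=> fcT.
suff base (x : T) : exists W : nat -> set T,
    (forall n, nbhs x (W n)) /\
    forall N, nbhs x N -> \forall n \near \oo, W n `<=` N.
  by have [W WP] := choice base; exists W.
have [B [cB Bx baseB]] := fcT x.
have [B0|[g]] := pfcard_geP cB.
  by have [V] := baseB setT filterT; rewrite B0.
exists (fun n => \bigcap_(k < n.+1) g k); split=> [n|N /baseB[V BV VN]].
  rewrite bigcap_mkord; elim/big_ind : _ => //; first exact: filterT.
    by move=> ? ?; exact: filterI.
  by move=> k _; apply: Bx; exact: funS.
have [k _ gk] := @surj _ _ _ _ g V BV.
exists k => // n kn y Wy; apply: VN; rewrite -gk.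
exact: Wy.
Qed.

(** Irreducibility read on complements: the open sets that meet [A] are closed
    under intersection. *)
Lemma irreducible_openI (A U V : set T) : irreducible A -> open U -> open V ->
  A `&` U !=set0 -> A `&` V !=set0 -> A `&` (U `&` V) !=set0.
Proof.
move=> [_ irrA] oU oV [x [Ax Ux]] [y [Ay Vy]]; apply: contrapT => AUV.
have [||z Az|/(_ x Ax)|/(_ y Ay)] := irrA (~` U) (~` V); rewrite ?closedC //.
by apply/not_andP => UVz; apply: AUV; exists z.
Qed.

Lemma irreducible_meets_nbhs (A : set T) (W : T -> set T) (s : seq T) :
  irreducible A -> (forall x, nbhs x (W x)) ->
  (forall x, x \in s -> A x) ->
  exists a, A a /\ forall x, x \in s -> W x a.
Proof.
move=> irrA Wx sA.
suff [U [oU [a [Aa Ua]] UW]] : exists U, [/\ open U, A `&` U !=set0 &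
    forall x, x \in s -> U `<=` W x].
  by exists a; split=> // x /UW; exact.
elim: s sA => [_|x s IHs sA].
  by exists setT; split=> //; [exact: openT|have [[a Aa] _] := irrA; exists a].
have [y ys|U [oU AU UW]] := IHs; first by apply: sA; rewrite inE ys orbT.
exists (interior (W x) `&` U); split.
  by apply: openI => //; exact: open_interior.
  apply: irreducible_openI => //; first exact: open_interior.
  by exists x; split; [apply: sA; rewrite inE eqxx|exact: Wx].
move=> y; rewrite inE => /predU1P[->|ys] z [Wz Uz]; first exact: interior_subset.
exact: UW ys _ Uz.
Qed.

(** The recursion carries the list [s n] of all points produced so far, with [x]
    and [y] at its end, and prepends a point of [A] that lies in a small
    neighbourhood of each of them; the size of the list serves as the index of
    that neighbourhood. *)
Lemma irreducible_self_convergent (A : set T) (x y : T) :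
  first_countable T -> irreducible A -> A x -> A y ->
  exists a : nat -> T, [/\ forall n, A (a n), forall n, a @ \oo --> a n,
    a @ \oo --> x & a @ \oo --> y].
Proof.
move=> /decreasing_nbhs_base[W Wbase] irrA Ax Ay.
(* The premise in the specification of [g] makes it total on lists, so that the
   sequence of lists can be defined before its members are known to be in [A]. *)
have /choice[g gP] : forall s : seq T, exists a, (forall z, z \in s -> A z) ->
    A a /\ forall z, z \in s -> W z (size s) a.
  move=> s; have [sA|nsA] := pselect (forall z, z \in s -> A z).
    have [a aP] :=
      irreducible_meets_nbhs irrA (fun z => (Wbase z).1 (size s)) sA.
    by exists a.
  by exists x.
pose s n := iter n (fun s => g s :: s) [:: x; y].
have sA n z : z \in s n -> A z.
  elim: n z => [|n IHn] z /=; rewrite inE; last first.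
    by move=> /predU1P[->|/IHn//]; have [] := gP _ IHn.
  by move=> /predU1P[->//|]; rewrite inE => /eqP ->.
have size_s n : size (s n) = n.+2 by elim: n => //= n ->.
have s_mono m n : m <= n -> {subset s m <= s n}.
  elim: n => [|n IHn]; first by rewrite leqn0 => /eqP ->.
  rewrite leq_eqVlt => /predU1P[->//|/IHn mn z /mn zn].
  by rewrite inE zn orbT.
have cvg_s m z : z \in s m -> (g \o s) @ \oo --> z.
  move=> zm N zN; have [k _ kN] := (Wbase z).2 N zN.
  exists (maxn k m) => // n; rewrite /= geq_max => /andP[kn mn].
  apply: (kN n.+2); first by rewrite /= !leqW.
  by rewrite -size_s; apply: (gP _ (@sA n)).2; exact: s_mono zm.
exists (g \o s); split.
- by move=> n; apply: (gP _ (@sA n)).1.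
- by move=> n; apply: (cvg_s n.+1); rewrite inE eqxx.
- by apply: (cvg_s 0); rewrite inE eqxx.
- by apply: (cvg_s 0); rewrite !inE eqxx orbT.
Qed.

Definition up_tail (a : nat -> T) n := \bigcup_(k in [set k | n <= k]) up (a k).

(** Given a filter on the tail that does not cluster at [a n], some member of the
    filter avoids a neighbourhood of [a n].  That neighbourhood contains
    [up (a k)] for almost all [k], so the filter lives on a finite union of
    compact sets. *)
Lemma compact_up_tail (a : nat -> T) n :
  a @ \oo --> a n -> compact (up_tail a n).
Proof.
move=> an F FF Fa.
have tail_n : up_tail a n (a n).
  by exists n => /=; [exact: leqnn|exact: specialization_refl].
have [clan|] := pselect (cluster F (a n)); first by exists (a n).
move=> /existsNP[B] /existsNP[N] /not_implyP[FB] /not_implyP[Nan BN].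
have [m _ mN] := an (interior N) (nbhs_interior Nan).
pose Kfin := \bigcup_(k in [set` iota n m]) up (a k).
have cKfin : compact Kfin.
  by rewrite /Kfin bigcup_seq; apply: bigsetU_compact => k _; exact: compact_up.
have [|p [[k] /=]] := cKfin F FF.
  apply: filterS (filterI Fa FB) => z [[k /= nk akz] Bz].
  have [mk|km] := leqP m k; last first.
    by exists k => //=; rewrite mem_iota nk /= ltn_addl.
  exfalso; apply: BN; exists z; split=> //.
  by apply: nbhs_specialization akz; exact: mN.
rewrite mem_iota => /andP[nk _] akp clp.
by exists p; split=> //; exists k.
Qed.

Lemma saturated_up_tail (a : nat -> T) n : saturated (up_tail a n).
Proof.
apply/saturatedP => x y [k nk akx] xy.
by exists k => //; exact: specialization_trans xy.
Qed.

(** The up-sets of tails of a self-convergent sequence in [A] all meet [A], so by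
    omega-well-filteredness they have a common point in [A].  Any neighbourhood
    of a limit of the sequence contains one of these tails, so the common point
    is above every limit. *)
Lemma irreducible_directed (A : set T) : first_countable T ->
  omega_well_filtered T -> closed A -> irreducible A ->
  directed specialization A.
Proof.
move=> fcT [_ wfT] cA irrA; split; first by case: irrA.
move=> x y Ax Ay.
have [a [Aa a_an ax ay]] := irreducible_self_convergent fcT irrA Ax Ay.
have tail_sub m n : m <= n -> up_tail a n `<=` up_tail a m.
  by move=> mn z [k /= nk akz]; exists k => //=; exact: leq_trans nk.
have tail_self n : up_tail a n (a n).
  by exists n => /=; [exact: leqnn|exact: specialization_refl].
have [z Az tailz] : exists2 z, A z & forall n, up_tail a n z.
  apply: contrapT => nz.
  have [|||z tailz Az|n tailA] := wfT (~` A) (up_tail a).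
  - by rewrite openC.
  - split; first by exists (up_tail a 0); exists 0.
    move=> _ _ [m _ <-] [n _ <-]; exists (up_tail a (maxn m n)).
    by split; [exists (maxn m n)|apply: tail_sub; exact: leq_maxl
              |apply: tail_sub; exact: leq_maxr].
  - move=> n; split; [by exists (a n)|exact: compact_up_tail
                     |exact: saturated_up_tail].
  - by apply: nz; exists z => // n; exact: tailz.
  - by apply: (tailA (a n) (tail_self n)); exact: Aa.
have below w : a @ \oo --> w -> specialization w z.
  move=> aw; apply/specializationP => N wN.
  have [m _ mN] := aw (interior N) (nbhs_interior wN).
  have [k /= mk akz] := tailz m.
  by apply: nbhs_specialization akz; exact: mN.
by exists z; split=> //; exact: below.
Qed.

Lemma omega_well_filtered_d_space_sober : first_countable T ->
  omega_well_filtered T -> d_space T -> sober T.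
Proof.
move=> fcT wfT [T0 dcpo scott] F cF irrF.
have dirF := irreducible_directed fcT wfT cF irrF.
have [s supFs] := dcpo F dirF.
have Fs : F s.
  apply: contrapT => nFs.
  have oF : open (~` F) by rewrite openC.
  by have [_ /(_ F s dirF supFs nFs)[x []]] := scott _ oF.
have FE : F = closure [set s].
  apply/seteqP; split; first exact: supFs.1.
  by apply: closure_sub_closed => // _ ->.
by exists s; split=> // t; rewrite FE; exact: (closure1_inj T0).
Qed.

End FirstCountable.

Theorem theorem4p2 (X : topologicalType)
    (X_first_countable : first_countable X) (X_T0 : kolmogorov_space X) :
  [<-> sober X;
       well_filtered X;
       omega_well_filtered X /\ d_space X].
Proof.
tfae.
- exact: sober_well_filtered.
- move=> wfX; split; first exact: well_filtered_omega.
  exact: well_filtered_d_space.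
- by move=> [owfX dX]; exact: omega_well_filtered_d_space_sober.
Qed.
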